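(* Let $f\in\mathcal{F}(\mathbb{R}^m)$ and $X=X_1\times\dots\times X_n$, where each $X_i$ is a nonempty polyhedron in $\mathbb{R}^{m_i}$ and $m_1+\dots+m_n=m$, and let $\nabla f$ be Lipschitz continuous coordinate-wise with block-diagonal Lipschitz matrix $L=\mathrm{diag}(L_1,\dots,L_n)$. Assume that $\min_{x\in X}f(x)$ has a unique solution $x^\star$, that strict complementarity holds at $x^\star$, and that $f$ is twice continuously differentiable in a neighborhood of $x^\star$. Consider the synchronous algorithm $x^{k+1}=J(f,x^k)$ implemented with step size $1$ in every coordinate direction and with scaling $x\mapsto T_i(f_{i:x},x_i)$ continuous at $x^\star$ for $i=1,\dots,n$. If $\{x^k\}$ is a sequence generated by the algorithm and converging towards $x^\star$, then $\{x^k\}$ converges with asymptotic rate (in the reduced space at $x^\star$) $$\tilde J=\tilde I-\tilde T\,\tilde\nabla^2f(x^\star),$$ i.e. for $k$ large enough $x^k=x^\star+E\tilde x^k$ with $\tilde x^k\in\mathbb{R}^{\tilde m}$, and $\tilde x^{k+1}=\tilde J\tilde x^k+o(\|\tilde x^k\|)$.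
   Context: $\|x\|_M=(x^\top Mx)^{1/2}$ for $M$ symmetric positive definite. $\mathcal{F}(\mathbb{R}^q)$ is the set of functions $\mathbb{R}^q\to\mathbb{R}$ that are strictly convex and continuously differentiable with Lipschitz continuous gradient. The Lipschitz hypothesis with symmetric positive definite $L=\mathrm{diag}(L_1,\dots,L_n)$, $L_i\in\mathbb{R}^{m_i\times m_i}$, means $\nabla f(x)^\top(y-x)\ge f(y)-f(x)-\tfrac12\|x-y\|_L^2$ for all $x,y$. Fix $0<t_{\min}\le t_{\max}<\infty$; $\mathcal{S}(\mathbb{R}^q)$ is the set of symmetric $M\in\mathbb{R}^{q\times q}$ with $t_{\min}I\preceq M\preceq t_{\max}I$. For $x\in X$, $f_{i:x}(y)=f(x_1,\dots,x_{i-1},y,x_{i+1},\dots,x_n)$ for $y\in\mathbb{R}^{m_i}$. With scaling mappings $T_i:\mathcal{F}(\mathbb{R}^{m_i})\times X_i\to\mathcal{S}(\mathbb{R}^{m_i})$, the coordinate gradient projection with step size $1$ is $$G_i(f,x)=\arg\min_{y\in X_i}\nabla f_{i:x}(x_i)^\top(y-x_i)+\tfrac12\|y-x_i\|^2_{T_i(f_{i:x},x_i)^{-1}}.$$ The synchronous (Jacobi) mapping is $J(f,x)=(G_1(f,x),\dots,G_n(f,x))$. $T(f,x)=\mathrm{diag}(T_1(f_{1:x},x_1),\dots,T_n(f_{n:x},x_n))$. Strict complementarity: writing $X=\{x: a_j^\top x\le b_j,\ j=1,\dots,p\}$ (each constraint involving a single block) and $\mathcal{A}(x)=\{j: a_j^\top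 x=b_j\}$, there are positive $\{\lambda_j\}_{j\in\mathcal{A}(x^\star)}$ with $\nabla f(x^\star)=-\sum_{j\in\mathcal{A}(x^\star)}\lambda_ja_j$. Reduced space: $E=\mathrm{diag}(E_1,\dots,E_n)\in\mathbb{R}^{m\times\tilde m}$, where the columns of $E_i\in\mathbb{R}^{m_i\times\tilde m_i}$ form an orthonormal basis of the subspace of $\mathbb{R}^{m_i}$ orthogonal to the normal vectors of the constraints of $X_i$ active at $x_i^\star$, and $\tilde m=\sum_i\tilde m_i$. Set $\tilde\nabla^2f(x^\star)=E^\top\nabla^2f(x^\star)E$, $\tilde T=[E^\top T(f,x^\star)^{-1}E]^{-1}$, and $\tilde I$ the identity of $\mathbb{R}^{\tilde m\times\tilde m}$. *)

(* Defs.v *)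
(* MathComp-Analysis.  R^q is the type 'cV[R]_q of column vectors.  Its library
   norm is the max norm; in finite dimension it can replace the Euclidean norm
   in limits, in little-o and in "there is a Lipschitz constant". *)
From HB Require Import structures.
From mathcomp Require Import all_boot all_order all_algebra.
From mathcomp Require Import all_classical all_reals all_analysis.

Set Implicit Arguments.
Unset Strict Implicit.
Unset Printing Implicit Defensive.

Import Order.TTheory GRing.Theory Num.Theory.
Import numFieldNormedType.Exports.

Local Open Scope classical_set_scope.
Local Open Scope ring_scope.

Section LinearAlgebra.
Context {R : realType}.

Definition dot q (u v : 'cV[R]_q) : R := (u^T *m v) ord0 ord0.

Definition normM q (M : 'M[R]_q) (x : 'cV[R]_q) : R :=
  Num.sqrt ((x^T *m M *m x) ord0 ord0).

Definition posdef q (M : 'M[R]_q) : Prop :=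
  M^T = M /\ forall v : 'cV[R]_q, v != 0 -> 0 < (v^T *m M *m v) ord0 ord0.

Definition loewner_le q (A B : 'M[R]_q) : Prop :=
  forall v : 'cV[R]_q,
    (v^T *m A *m v) ord0 ord0 <= (v^T *m B *m v) ord0 ord0.

(* The set S(R^q). *)
Definition scaling_set (tmin tmax : R) q : set 'M[R]_q :=
  [set M | [/\ M^T = M, loewner_le tmin%:M M & loewner_le M tmax%:M]].

(* Rectangular counterpart of the library's [mxdiag], which only takes square
   blocks; as there, [conform_mx] is the identity on the diagonal blocks. *)
Definition blockdiag n (p q : 'I_n -> nat) (B : forall i, 'M[R]_(p i, q i)) :
    'M[R]_(\sum_i p i, \sum_i q i) :=
  \mxblock_(i < n, j < n) (if i == j then conform_mx 0 (B i) else 0).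

End LinearAlgebra.

Section Calculus.
Context {R : realType}.

Definition gradient q (f : 'cV[R]_q -> R) (x : 'cV[R]_q) : 'cV[R]_q :=
  \col_k 'D_(delta_mx k ord0) f x.

Definition hessian q (f : 'cV[R]_q -> R) (x : 'cV[R]_q) : 'M[R]_q :=
  \matrix_(k, l) 'D_(delta_mx l ord0) (fun y => gradient f y k ord0) x.

Definition strictly_convex q (f : 'cV[R]_q -> R) : Prop :=
  forall (x y : 'cV[R]_q) (t : R), x != y -> 0 < t -> t < 1 ->
    f (t *: x + (1 - t) *: y) < t * f x + (1 - t) * f y.

(* The set F(R^q). *)
Definition smooth_convex q : set ('cV[R]_q -> R) :=
  [set f | [/\ strictly_convex f,
               forall x, differentiable f x,
               continuous (gradient f)
             & lipschitz (gradient f)]].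

Definition twice_cont_diff_near q (f : 'cV[R]_q -> R) (x0 : 'cV[R]_q) : Prop :=
  \forall x \near x0,
    [/\ differentiable f x, differentiable (gradient f) x
      & {for x, continuous (hessian f)}].

Definition lipschitz_matrix q (f : 'cV[R]_q -> R) (L : 'M[R]_q) : Prop :=
  forall x y : 'cV[R]_q,
    dot (gradient f x) (y - x) >= f y - f x - 2^-1 * normM L (x - y) ^+ 2.

Definition argmin (V : Type) (S : set V) (phi : V -> R) : set V :=
  [set y | S y /\ forall z, S z -> phi y <= phi z].

End Calculus.

Section Blocks.
Context {R : realType} {n : nat} {m : 'I_n -> nat}.
Local Notation vec := 'cV[R]_(\sum_i m i).

Definition prodset (X : forall i, set 'cV[R]_(m i)) : set vec :=
  [set x | forall i, X i (submxcol x i)].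

(* A system of p inequalities a_j^T x <= b_j on R^m, the j-th of which involves
   only the block [blk j] of x. *)
Definition single_block p (a : 'I_p -> vec) (blk : 'I_p -> 'I_n) : Prop :=
  forall j i, i != blk j -> submxcol (a j) i = 0.

Definition block_polyhedron p (a : 'I_p -> vec) (b : 'I_p -> R)
    (blk : 'I_p -> 'I_n) (i : 'I_n) : set 'cV[R]_(m i) :=
  [set y | forall j, blk j = i -> dot (submxcol (a j) i) y <= b j].

Definition active p (a : 'I_p -> vec) (b : 'I_p -> R) (x : vec) : pred 'I_p :=
  fun j => dot (a j) x == b j.

Definition strict_complementarity p (a : 'I_p -> vec) (b : 'I_p -> R)
    (f : vec -> R) (xs : vec) : Prop :=
  exists lambda : 'I_p -> R,
    (forall j, active a b xs j -> 0 < lambda j) /\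
    gradient f xs = - \sum_(j | active a b xs j) lambda j *: a j.

(* The columns of Ei are an orthonormal basis of the subspace of R^(m_i)
   orthogonal to the normals of the constraints of X_i active at xs_i. *)
Definition reduced_basis p (a : 'I_p -> vec) (b : 'I_p -> R)
    (blk : 'I_p -> 'I_n) (xs : vec) (i : 'I_n) q (Ei : 'M[R]_(m i, q)) : Prop :=
  Ei^T *m Ei = 1%:M /\
  forall y : 'cV[R]_(m i),
    (exists z : 'cV[R]_q, y = Ei *m z) <->
    (forall j, blk j = i -> active a b xs j -> dot (submxcol (a j) i) y = 0).

(* f_{i:x}; [dfwith] replaces the i-th block of x by y. *)
Definition slice (f : vec -> R) (x : vec) (i : 'I_n) (y : 'cV[R]_(m i)) : R :=
  f (\mxcol_j dfwith (submxcol x) i y j).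

Arguments slice f x i y : clear implicits.

Definition scaling_map :=
  forall i, ('cV[R]_(m i) -> R) -> 'cV[R]_(m i) -> 'M[R]_(m i).

Definition scaling_at (T : scaling_map) (f : vec -> R) (x : vec) (i : 'I_n) :
    'M[R]_(m i) :=
  T i (slice f x i) (submxcol x i).

(* G_i(f,x): the element of the argmin; the default value 0 of [xget] would only
   be taken if the argmin were empty. *)
Definition grad_proj (X : forall i, set 'cV[R]_(m i)) (T : scaling_map)
    (f : vec -> R) (x : vec) (i : 'I_n) : 'cV[R]_(m i) :=
  let xi := submxcol x i in
  xget 0 (argmin (X i) (fun y =>
    dot (gradient (slice f x i) xi) (y - xi)
    + 2^-1 * normM (invmx (scaling_at T f x i)) (y - xi) ^+ 2)).

Definition jacobi (X : forall i, set 'cV[R]_(m i)) (T : scaling_map)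
    (f : vec -> R) (x : vec) : vec :=
  \mxcol_i grad_proj X T f x i.

End Blocks.

Arguments block_polyhedron {R n m p} a b blk i.
Arguments slice {R n m} f x i y.
Arguments scaling_map : clear implicits.
Arguments smooth_convex : clear implicits.

Section ReducedSpace.
Context {R : realType} {q r : nat}.

Definition reduced_hessian (E : 'M[R]_(q, r)) (f : 'cV[R]_q -> R)
    (xs : 'cV[R]_q) : 'M[R]_r :=
  E^T *m hessian f xs *m E.

Definition reduced_scaling (E : 'M[R]_(q, r)) (T : 'M[R]_q) : 'M[R]_r :=
  invmx (E^T *m invmx T *m E).

End ReducedSpace.

(* Main.v *)
Require Import Defs.
From HB Require Import structures.
From mathcomp Require Import all_boot all_order all_algebra.
From mathcomp Require Import all_classical all_reals all_analysis.
From mathcomp Require Import ring lra.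

Set Implicit Arguments.
Unset Strict Implicit.
Unset Printing Implicit Defensive.

Import Order.TTheory GRing.Theory Num.Theory.
Import numFieldNormedType.Exports.

Local Open Scope classical_set_scope.
Local Open Scope ring_scope.

(** Write [M_k] for the block-diagonal matrix of the inverse scalings at [x k].
    The blockwise optimality conditions of the Jacobi step say that [x (k+1)]
    solves the variational inequality [<w_k, z - x (k+1)> >= 0] for all feasible
    [z], where [w_k = grad f (x k) + M_k (x (k+1) - x k)] ([jacobi_VI]; this uses
    that slices of [f] are smooth and convex, so that the scalings are positive
    definite and the minimizers exist).

    Since [x k] converges and the scalings are continuous at [xs], [w_k] tends
    to [grad f xs], which by strict complementarity is minus a positive
    combination of the active normals.  Since there are finitely many possible
    active sets, it follows, without any multiplier for the iterates, that the
    iterates eventually have exactly the active constraints of [xs]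
    ([active_set_identification] and [tight_near_active]).  So eventually
    [x k - xs] lies in the range of [E], and all [E v] and [- E v] are feasible
    directions at [x (k+1)], so that [E^T w_k = 0].

    Expanding [grad f] to first order at [xs] in this equation, using
    [E^T grad f xs = 0] and inverting [E^T M_k E], which converges to the
    invertible [E^T M E] with [M] the limit of [M_k], gives the linear recursion up to a little-o
    ([reduced_rate]). *)

(** * The dot product, limits and norms of matrices *)

Section DotProduct.
Context {R : realType}.

Lemma dotE q (u v : 'cV[R]_q) : dot u v = \sum_i u i ord0 * v i ord0.
Proof. by rewrite /dot mxE; apply: eq_bigr => i _; rewrite mxE. Qed.

Lemma dotC q (u v : 'cV[R]_q) : dot u v = dot v u.
Proof. by rewrite !dotE; apply: eq_bigr => i _; rewrite mulrC. Qed.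

Lemma dotDr q (u v w : 'cV[R]_q) : dot u (v + w) = dot u v + dot u w.
Proof. by rewrite /dot mulmxDr mxE. Qed.

Lemma dotZr q (u v : 'cV[R]_q) t : dot u (t *: v) = t * dot u v.
Proof. by rewrite /dot -scalemxAr mxE. Qed.

Lemma dotNr q (u v : 'cV[R]_q) : dot u (- v) = - dot u v.
Proof. by rewrite -scaleN1r dotZr mulN1r. Qed.

Lemma dotBr q (u v w : 'cV[R]_q) : dot u (v - w) = dot u v - dot u w.
Proof. by rewrite dotDr dotNr. Qed.

Lemma dotDl q (u v w : 'cV[R]_q) : dot (v + w) u = dot v u + dot w u.
Proof. by rewrite dotC dotDr !(dotC u). Qed.

Lemma dotZl q (u v : 'cV[R]_q) t : dot (t *: v) u = t * dot v u.
Proof. by rewrite dotC dotZr dotC. Qed.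

Lemma dotNl q (u v : 'cV[R]_q) : dot (- v) u = - dot v u.
Proof. by rewrite dotC dotNr dotC. Qed.

Lemma dot0r q (u : 'cV[R]_q) : dot u 0 = 0.
Proof. by rewrite -(scale0r 0) dotZr mul0r. Qed.

Lemma dot_suml q (I : finType) (P : pred I) (F : I -> 'cV[R]_q) u :
  dot (\sum_(i | P i) F i) u = \sum_(i | P i) dot (F i) u.
Proof.
apply: (big_morph (fun v => dot v u)) => [v w|]; first by rewrite dotDl.
by rewrite dotC dot0r.
Qed.

Lemma dot_mulmxr q r (u : 'cV[R]_q) (A : 'M[R]_(q, r)) (v : 'cV[R]_r) :
  dot u (A *m v) = dot (A^T *m u) v.
Proof. by rewrite /dot trmx_mul trmxK mulmxA. Qed.

Lemma quad_formE q (A : 'M[R]_q) (v : 'cV[R]_q) :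
  (v^T *m A *m v) ord0 ord0 = dot v (A *m v).
Proof. by rewrite /dot mulmxA. Qed.

Lemma dot_ge0 q (u : 'cV[R]_q) : 0 <= dot u u.
Proof. by rewrite dotE sumr_ge0 // => i _; rewrite -expr2 sqr_ge0. Qed.

Lemma coord_sqr_le_dot q (u : 'cV[R]_q) i : u i ord0 ^+ 2 <= dot u u.
Proof.
rewrite dotE (bigD1 i)//= -expr2 lerDl sumr_ge0 // => j _.
by rewrite -expr2 sqr_ge0.
Qed.

Lemma dot_eq0 q (u : 'cV[R]_q) : dot u u = 0 -> u = 0.
Proof.
move=> u0; apply/colP => i; rewrite mxE; apply/eqP.
by rewrite -sqrf_eq0 eq_le sqr_ge0 andbT -u0 coord_sqr_le_dot.
Qed.

Lemma dot_nondegenerate q (u : 'cV[R]_q) : (forall v, dot u v = 0) -> u = 0.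
Proof. by move=> /(_ u)/dot_eq0. Qed.

End DotProduct.

Section MatrixLimits.
Context {R : realType} {T : Type} {F : set_system T} {FF : Filter F}.

Lemma cvg_mxP m n (A : T -> 'M[R]_(m, n)) (B : 'M[R]_(m, n)) :
  A @ F --> B <-> forall i j, A k i j @[k --> F] --> B i j.
Proof.
split=> [AB i j|AB]; first
  exact: (continuous_cvg _ (@coord_continuous _ _ _ i j B) AB).
apply/cvgrPdist_le => e e0; near=> k.
rewrite [leLHS]/Num.Def.normr/= mx_normrE (bigmax_le _ (ltW e0))//= => i _.
rewrite !mxE; move: i; near: k; apply: filter_forall => -[i j] /=.
by have /cvgrPdist_le := AB i j; exact.
Unshelve. all: by end_near. Qed.

Lemma cvg_sum_fin (I : Type) (r : seq I) (P : pred I) (f : I -> T -> R)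
    (l : I -> R) :
  (forall i, P i -> f i @ F --> l i) ->
  \sum_(i <- r | P i) f i k @[k --> F] --> \sum_(i <- r | P i) l i.
Proof. by move=> fl; apply: cvg_big => //; exact: add_continuous. Qed.

Lemma cvg_prod_fin (I : Type) (r : seq I) (P : pred I) (f : I -> T -> R)
    (l : I -> R) :
  (forall i, P i -> f i @ F --> l i) ->
  \prod_(i <- r | P i) f i k @[k --> F] --> \prod_(i <- r | P i) l i.
Proof. by move=> fl; apply: cvg_big => //; exact: mul_continuous. Qed.

Lemma cvg_sub_limit m n (A : T -> 'M[R]_(m, n)) (B : 'M[R]_(m, n)) :
  A @ F --> B -> A k - B @[k --> F] --> (0 : 'M[R]_(m, n)).
Proof. by move=> AB; rewrite -(subrr B); apply: cvgB => //; exact: cvg_cst. Qed.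

Lemma cvg_limit_sub m n (A : T -> 'M[R]_(m, n)) (B : 'M[R]_(m, n)) :
  A @ F --> B -> B - A k @[k --> F] --> (0 : 'M[R]_(m, n)).
Proof. by move=> AB; rewrite -(subrr B); apply: cvgB => //; exact: cvg_cst. Qed.

Lemma cvg_mulmx m n p (A : T -> 'M[R]_(m, n)) (A0 : 'M[R]_(m, n))
    (B : T -> 'M[R]_(n, p)) (B0 : 'M[R]_(n, p)) :
  A @ F --> A0 -> B @ F --> B0 -> A k *m B k @[k --> F] --> A0 *m B0.
Proof.
move=> /cvg_mxP AA /cvg_mxP BB; apply/cvg_mxP => i j; rewrite mxE.
under eq_cvg do rewrite mxE.
by apply: cvg_sum_fin => l _; apply: cvgM.
Qed.

Lemma cvg_dot q (u v : T -> 'cV[R]_q) (u0 v0 : 'cV[R]_q) :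
  u @ F --> u0 -> v @ F --> v0 -> dot (u k) (v k) @[k --> F] --> dot u0 v0.
Proof.
move=> /cvg_mxP uu /cvg_mxP vv; rewrite dotE.
under eq_cvg do rewrite dotE.
by apply: cvg_sum_fin => l _; apply: cvgM.
Qed.

Lemma cvg_mulmxr m n p (A : 'M[R]_(m, n)) (B : T -> 'M[R]_(n, p))
    (B0 : 'M[R]_(n, p)) :
  B @ F --> B0 -> A *m B k @[k --> F] --> A *m B0.
Proof. by move=> BB; apply: (cvg_mulmx (A := fun=> A)) => //; apply: cvg_cst. Qed.

Lemma cvg_dotr q u (v : T -> 'cV[R]_q) (v0 : 'cV[R]_q) :
  v @ F --> v0 -> dot u (v k) @[k --> F] --> dot u v0.
Proof. by move=> vv; apply: (cvg_dot (u := fun=> u)) => //; apply: cvg_cst. Qed.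

Lemma cvg_det n (A : T -> 'M[R]_n) (A0 : 'M[R]_n) :
  A @ F --> A0 -> \det (A k) @[k --> F] --> \det A0.
Proof.
move=> /cvg_mxP AA; apply: cvg_sum_fin => s _; apply: cvgM; first exact: cvg_cst.
by apply: cvg_prod_fin => i _; exact: AA.
Qed.

Lemma near_unitmx n (A : T -> 'M[R]_n) (A0 : 'M[R]_n) : A0 \in unitmx ->
  A @ F --> A0 -> \forall k \near F, A k \in unitmx.
Proof.
rewrite unitmxE unitfE => A0_neq0 /cvg_det/cvgr_neq0/(_ A0_neq0).
by apply: filterS => k; rewrite unitmxE unitfE.
Qed.

Lemma cvg_invmx n (A : T -> 'M[R]_n) (A0 : 'M[R]_n) : A0 \in unitmx ->
  A @ F --> A0 -> invmx (A k) @[k --> F] --> invmx A0.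
Proof.
move=> uA0 AA; have dA := cvg_det AA; have uA := near_unitmx uA0 AA.
rewrite {2}/invmx uA0; 
apply: (cvg_trans (G := (\det (A k))^-1 *: \adj (A k) @[k --> F])).
  by apply: near_eq_cvg; near=> k; rewrite /invmx ifT//; near: k.
apply: cvgZ; first by apply: cvgV => //; rewrite -unitfE -unitmxE.
apply/cvg_mxP => i j; rewrite mxE; under eq_cvg do rewrite mxE.
apply: cvgM; first exact: cvg_cst.
apply: cvg_det; apply/cvg_mxP => k l; rewrite !mxE.
by under eq_cvg do rewrite !mxE; move/cvg_mxP : AA; exact.
Unshelve. all: by end_near. Qed.

Lemma cvg_mxdiag n (m : 'I_n -> nat) (A : T -> forall i, 'M[R]_(m i))
    (A0 : forall i, 'M[R]_(m i)) :
  (forall i, A k i @[k --> F] --> A0 i) ->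
  \mxdiag_i A k i @[k --> F] --> \mxdiag_i A0 i.
Proof.
move=> AA; apply/cvg_mxP => s t; rewrite /mxdiag /mxblock.
rewrite (_ : (fun k => _) = fun k => (if tagnat.sig1 s == tagnat.sig1 t
    then conform_mx 0 (A k (tagnat.sig1 s)) else 0) (tagnat.sig2 s)
    (tagnat.sig2 t)); last by apply/funext => k; rewrite mxE.
rewrite mxE; move: (tagnat.sig2 t).
case: eqP => [<- t'|_ t']; last by rewrite mxE; exact: cvg_cst.
rewrite conform_mx_id; under eq_cvg do rewrite conform_mx_id.
by move/cvg_mxP: (AA (tagnat.sig1 s)); exact.
Qed.

End MatrixLimits.

Section MatrixNorm.
Context {R : realType}.

Lemma coord_le_norm m n (A : 'M[R]_(m, n)) i j : `|A i j| <= `|A|.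
Proof.
by rewrite [leRHS]/Num.Def.normr/= mx_normrE; exact: (le_bigmax _ _ (i, j)).
Qed.

Lemma mx_norm_leP m n (A : 'M[R]_(m, n)) c : 0 <= c ->
  (forall i j, `|A i j| <= c) -> `|A| <= c.
Proof.
move=> c0 Ac; rewrite [leLHS]/Num.Def.normr/= mx_normrE.
by apply: bigmax_le => // -[].
Qed.

Lemma ler_norm_mulmx m n p (A : 'M[R]_(m, n)) (B : 'M[R]_(n, p)) :
  `|A *m B| <= n%:R * `|A| * `|B|.
Proof.
apply: mx_norm_leP => [|i j]; first by rewrite !mulr_ge0.
rewrite mxE (le_trans (ler_norm_sum _ _ _))//.
rewrite -mulrA mulr_natl -[X in _ *+ X]card_ord -sumr_const ler_sum // => k _.
by rewrite normrM ler_pM// coord_le_norm.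
Qed.

Lemma mulmx_continuous m n p (A : 'M[R]_(m, n)) :
  continuous (fun B : 'M[R]_(n, p) => A *m B).
Proof. by move=> B; apply: (cvg_mulmxr (F := nbhs B)). Qed.

End MatrixNorm.

(** * Scaling matrices and quadratic minimization over closed convex sets *)

Section ScalingMatrices.
Context {R : realType}.

Lemma unitmx_injective q (A : 'M[R]_q) :
  (forall v : 'cV[R]_q, A *m v = 0 -> v = 0) -> A \in unitmx.
Proof.
move=> Ainj; rewrite -unitmx_tr -row_free_unit; apply: inj_row_free => v vA.
apply: trmx_inj; rewrite trmx0; apply: Ainj.
by apply: trmx_inj; rewrite trmx_mul trmxK vA trmx0.
Qed.

Lemma scaling_set_dot_ge tmin tmax q (T : 'M[R]_q) v :
  scaling_set tmin tmax T -> tmin * dot v v <= dot v (T *m v).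
Proof.
by case=> _ /(_ v) + _; rewrite !quad_formE mul_scalar_mx dotZr.
Qed.

Lemma scaling_set_dot_le tmin tmax q (T : 'M[R]_q) v :
  scaling_set tmin tmax T -> dot v (T *m v) <= tmax * dot v v.
Proof.
by case=> _ _ /(_ v); rewrite !quad_formE mul_scalar_mx dotZr.
Qed.

Lemma scaling_set_unit tmin tmax q (T : 'M[R]_q) :
  0 < tmin -> scaling_set tmin tmax T -> T \in unitmx.
Proof.
move=> tmin0 ST; apply: unitmx_injective => v Tv; apply: dot_eq0.
have := scaling_set_dot_ge v ST; rewrite Tv dot0r pmulr_rle0// => vv.
by apply/eqP; rewrite eq_le vv dot_ge0.
Qed.

Lemma scaling_set_invmx_sym tmin tmax q (T : 'M[R]_q) :
  scaling_set tmin tmax T -> (invmx T)^T = invmx T.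
Proof. by case=> Tsym _ _; rewrite trmx_inv Tsym. Qed.

(** The upper bound [T <= tmax I] gives [T^-1 >= tmax^-1 I]: expand
    [0 <= <u - s v, T (u - s v)>] with [u = T^-1 v] and [s = tmax^-1]. *)
Lemma scaling_set_invmx_ge tmin tmax q (T : 'M[R]_q) v :
  0 < tmin -> 0 < tmax -> scaling_set tmin tmax T ->
  tmax^-1 * dot v v <= dot v (invmx T *m v).
Proof.
move=> tmin0 tmax0 ST; set s := tmax^-1; set u := invmx T *m v.
have Tu : T *m u = v by rewrite mulKVmx// (scaling_set_unit tmin0 ST).
have Tsym : T^T = T by case: ST.
have : 0 <= dot (u - s *: v) (T *m (u - s *: v)).
  apply: le_trans (scaling_set_dot_ge _ ST).
  by rewrite mulr_ge0 ?dot_ge0// ltW.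
rewrite mulmxBr Tu -scalemxAr !(dotBr, dotDl, dotNl, dotZl, dotZr).
rewrite (dot_mulmxr u T) Tsym Tu (dotC u v).
have := scaling_set_dot_le v ST; have ss : s * tmax = 1 by rewrite mulVf// gt_eqF.
have s0 : 0 < s by rewrite invr_gt0.
move=> /(ler_wpM2l (ltW s0)); rewrite (mulrA s tmax) ss mul1r.
move=> /(ler_wpM2l (ltW s0)).
by nra.
Qed.

Lemma normM_sqr q (M : 'M[R]_q) v :
  0 <= dot v (M *m v) -> normM M v ^+ 2 = dot v (M *m v).
Proof. by move=> v0; rewrite /normM sqr_sqrtr quad_formE. Qed.

End ScalingMatrices.

Section Minimization.
Context {R : realType}.

Lemma coercive_argmin_nonempty q (X : set 'cV[R]_q) (phi : 'cV[R]_q -> R) :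
  closed X -> X !=set0 -> continuous phi ->
  (forall c, exists B, forall y, phi y <= c -> `|y| <= B) ->
  argmin X phi !=set0.
Proof.
move=> clX [z0 Xz0] cphi coer.
(* Minimize over the sublevel set of [phi] at a feasible point [z0]; transposed,
   it is a closed and bounded, hence compact, set of row vectors. *)
have ctr : continuous (fun r : 'rV[R]_q => r^T).
  move=> r; apply/(cvg_mxP (F := nbhs r)) => i j.
  rewrite mxE; under eq_cvg do rewrite mxE; exact: coord_continuous.
pose A := [set r : 'rV[R]_q | X r^T] `&` [set r | phi r^T <= phi z0].
have cA : compact A.
  apply: bounded_closed_compact.
    have [B HB] := coer (phi z0).
    exists B; split; first exact: num_real.
    move=> M BM r [_ /HB rB]; apply: le_trans (le_trans rB (ltW BM)).
    apply: mx_norm_leP => // i j.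
    have -> : r i j = r^T j i by rewrite mxE.
    exact: coord_le_norm.
  apply: closedI.
    by apply: (closed_comp (f := trmx)) => // r _; exact: ctr.
  apply: (closed_comp (f := phi \o trmx) (D := [set y | y <= phi z0])).
    move=> r _; apply: continuous_comp; [exact: ctr|exact: cphi].
  exact: closed_le.
have [||c] := compact_EVT_min _ cA (f := phi \o trmx).
- by exists z0^T; split; rewrite /= trmxK.
- apply: continuous_subspaceT => r.
  apply: continuous_comp; [exact: ctr|exact: cphi].
rewrite inE => -[Xc cz0] cmin; exists c^T; split => // z Xz.
have [zz0|/ltW z0z] := leP (phi z) (phi z0); last exact: le_trans z0z.
have := cmin z^T; rewrite inE /= trmxK; apply.
by split; rewrite /= trmxK.
Qed.

(** First-order optimality of [y] for a quadratic over a convex set: otherwise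
    a short step from [y] towards [z] would decrease the quadratic. *)
Lemma argmin_quadratic_VI q (X : set 'cV[R]_q) (g x0 y z : 'cV[R]_q)
    (M : 'M[R]_q) :
  (forall u v t, X u -> X v -> 0 <= t <= 1 -> X (u + t *: (v - u))) ->
  M^T = M ->
  argmin X (fun y => dot g (y - x0) + 2^-1 * dot (y - x0) (M *m (y - x0))) y ->
  X z -> 0 <= dot (g + M *m (y - x0)) (z - y).
Proof.
move=> cvxX Msym [Xy ymin] Xz; set w := g + _; set d := z - y.
rewrite leNgt; apply/negP => wd.
pose Q := dot d (M *m d).
have key t : 0 <= t <= 1 -> 0 <= t * dot w d + 2^-1 * t ^+ 2 * Q.
  move=> t01; have /= := ymin _ (cvxX _ _ _ Xy Xz t01); rewrite -/d.
  rewrite (addrAC y).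
  set e := y - x0; rewrite (mulmxDr M e) -scalemxAr (dotDr g e).
  rewrite !(dotDl _ e) !(dotDr _ (M *m e)) !(dotZl, dotZr).
  have -> : dot e (M *m d) = dot d (M *m e) by rewrite dot_mulmxr Msym dotC.
  rewrite -/Q /w dotDl -/e (dotC (M *m e)).
  by rewrite -subr_ge0; lra.
(* A step this short makes the linear term dominate the quadratic one. *)
pose t := Num.min 1 (- dot w d / (`|Q| + 1)).
have t0 : 0 < t by rewrite lt_min ltr01 divr_gt0 ?oppr_gt0 ?ltr_wpDl.
have t1 : t <= 1 by rewrite ge_min lexx.
have tQ : t * (`|Q| + 1) <= - dot w d.
  by rewrite -ler_pdivlMr ?ltr_wpDl// ge_min lexx orbT.
have := key t; rewrite (ltW t0) t1 => /(_ isT).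
have QQ : Q <= `|Q| := ler_norm Q.
have : t * (`|Q| + 1) * t <= - dot w d * t by rewrite ler_pM2r.
have := ler_wpM2r (sqr_ge0 t) QQ; have := normr_ge0 Q.
have : 0 < t ^+ 2 by rewrite exprn_gt0.
have : t * dot w d < 0 by rewrite pmulr_rlt0.
clear key; clearbody Q; nra.
Qed.

(** The bound comes from [0 <= |g + (s / 2) d|^2] with [d = y - x0], which gives
    [- <g, d> <= |g|^2 / s + (s / 4) |d|^2]. *)
Lemma quadratic_coercive q (g x0 : 'cV[R]_q) (M : 'M[R]_q) s : 0 < s ->
  (forall v, s * dot v v <= dot v (M *m v)) ->
  forall c, exists B, forall y,
    dot g (y - x0) + 2^-1 * dot (y - x0) (M *m (y - x0)) <= c -> `|y| <= B.
Proof.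
move=> s0 Ms c; pose D := 4 / s * (c + dot g g / s).
exists (`|x0| + (1 + `|D|)) => y.
have -> : `|y| = `|x0 + (y - x0)| by rewrite addrC subrK.
move: (y - x0) => d cd.
rewrite (le_trans (ler_normD _ _))// lerD2l.
have dD : dot d d <= D.
  have := dot_ge0 (g + (s / 2) *: d); rewrite !(dotDr, dotDl, dotZr, dotZl).
  rewrite (dotC d g) => H.
  have H2 : 0 <= (dot g g + (s / 2 * dot g d + s / 2 * (dot g d + s / 2 * dot d d))) / s.
    by apply: divr_ge0 (ltW s0); nra.
  have E : (dot g g + (s / 2 * dot g d + s / 2 * (dot g d + s / 2 * dot d d))) / s
     = dot g g / s + dot g d + s / 4 * dot d d by field; rewrite gt_eqF.
  rewrite E in H2; have := Ms d => Msd.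
  rewrite /D mulrAC ler_pdivlMr// mulrC; lra.
apply: mx_norm_leP => [|i j]; first by rewrite addr_ge0.
rewrite ord1 -(@ler_pXn2r _ 2) ?nnegrE ?addr_ge0// real_normK ?num_real//.
rewrite (le_trans (coord_sqr_le_dot d i))// (le_trans dD)//.
rewrite (le_trans (ler_norm D))//; have := normr_ge0 D; nra.
Qed.

Lemma cvg_quadratic {T : Type} {F : set_system T} {FF : Filter F} q
    (g x0 y0 : 'cV[R]_q) (M : 'M[R]_q) (y : T -> 'cV[R]_q) :
  y @ F --> y0 ->
  dot g (y k - x0) + 2^-1 * dot (y k - x0) (M *m (y k - x0)) @[k --> F] -->
  dot g (y0 - x0) + 2^-1 * dot (y0 - x0) (M *m (y0 - x0)).
Proof.
move=> yy; have yx : y k - x0 @[k --> F] --> y0 - x0.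
  by apply: cvgB => //; exact: cvg_cst.
apply: cvgD; first exact: cvg_dotr.
apply: cvgM; first exact: cvg_cst.
by apply: cvg_dot => //; exact: cvg_mulmxr.
Qed.

Lemma quadratic_argmin_nonempty q (X : set 'cV[R]_q) (g x0 : 'cV[R]_q)
    (M : 'M[R]_q) s :
  closed X -> X !=set0 -> 0 < s ->
  (forall v, s * dot v v <= dot v (M *m v)) ->
  argmin X (fun y => dot g (y - x0) + 2^-1 * dot (y - x0) (M *m (y - x0)))
    !=set0.
Proof.
move=> clX X0 s0 Ms; apply: coercive_argmin_nonempty => //.
  by move=> y; apply: (cvg_quadratic (F := nbhs y)).
exact: quadratic_coercive Ms.
Qed.

End Minimization.

(** * Block vectors, block polyhedra and slices *)

Section BlockVectors.
Context {R : realType} {n : nat} {m : 'I_n -> nat}.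
Local Notation vec := 'cV[R]_(\sum_i m i).

Lemma dot_blocks (u v : vec) :
  dot u v = \sum_i dot (submxcol u i) (submxcol v i).
Proof.
rewrite {1}/dot -{1}(submxcolK u) -{1}(submxcolK v) tr_mxcol mul_mxrow_mxcol.
by rewrite summxE.
Qed.

Lemma submxcol_mxdiag_mul (D : forall i, 'M[R]_(m i)) (v : vec) i :
  submxcol (mxdiag D *m v) i = D i *m submxcol v i.
Proof. by rewrite -{1}(submxcolK v) mul_mxdiag_mxcol mxcolK. Qed.

Lemma mxdiag_dot (D : forall i, 'M[R]_(m i)) (u v : vec) :
  dot u (mxdiag D *m v) =
  \sum_i dot (submxcol u i) (D i *m submxcol v i).
Proof.
by rewrite dot_blocks; apply: eq_bigr => i _; rewrite submxcol_mxdiag_mul.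
Qed.

Lemma invmx_mxdiag (D : forall i, 'M[R]_(m i)) :
  (forall i, D i \in unitmx) -> invmx (mxdiag D) = \mxdiag_i invmx (D i).
Proof.
move=> uD; have DD : mxdiag D *m \mxdiag_i invmx (D i) = 1%:M.
  rewrite [X in _ *m X]/mxdiag mul_mxdiag_mxblock -mxdiagZ /mxdiag.
  apply/eq_mxblock => i j; case: eqP => [<-|_]; last by rewrite mulmx0.
  by rewrite !conform_mx_id mulmxV.
have /mulmx1_unit[uDD _] := DD.
by rewrite -[RHS](mulKmx uDD) DD mulmx1.
Qed.

Lemma scaling_set_mxdiag tmin tmax (D : forall i, 'M[R]_(m i)) :
  (forall i, scaling_set tmin tmax (D i)) -> scaling_set tmin tmax (mxdiag D).
Proof.
move=> SD; split.
- by rewrite tr_mxdiag; apply/eq_mxdiag => i; case: (SD i).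
- move=> v; rewrite !quad_formE mul_scalar_mx dotZr mxdiag_dot dot_blocks.
  by rewrite mulr_sumr ler_sum// => i _; exact: scaling_set_dot_ge (SD i).
- move=> v; rewrite !quad_formE mul_scalar_mx dotZr mxdiag_dot dot_blocks.
  by rewrite mulr_sumr ler_sum// => i _; exact: scaling_set_dot_le (SD i).
Qed.

Lemma dot_single_block p (a : 'I_p -> vec) (blk : 'I_p -> 'I_n) j (v : vec) :
  single_block a blk ->
  dot (a j) v = dot (submxcol (a j) (blk j)) (submxcol v (blk j)).
Proof.
move=> a_block; rewrite dot_blocks (bigD1 (blk j))//= big1 ?addr0// => i ij.
by rewrite a_block// dotC dot0r.
Qed.

(** A product of block polyhedra is the polyhedron cut out by all the
    constraints together. *)
Lemma prodset_polyhedronP p (a : 'I_p -> vec) (b : 'I_p -> R)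
    (blk : 'I_p -> 'I_n) (x : vec) : single_block a blk ->
  prodset (block_polyhedron a b blk) x <-> forall j, dot (a j) x <= b j.
Proof.
move=> a_block; split=> [Px j|Px i j <-].
  by rewrite (dot_single_block _ _ a_block); apply: Px.
by rewrite -(dot_single_block _ _ a_block).
Qed.

Lemma block_polyhedron_convex p (a : 'I_p -> vec) (b : 'I_p -> R)
    (blk : 'I_p -> 'I_n) i (u v : 'cV[R]_(m i)) t :
  block_polyhedron a b blk i u -> block_polyhedron a b blk i v ->
  0 <= t <= 1 -> block_polyhedron a b blk i (u + t *: (v - u)).
Proof.
move=> Pu Pv /andP[t0 t1] j ij; have := Pu j ij; have := Pv j ij.
rewrite dotDr dotZr dotBr => H1 H2; nra.
Qed.

Lemma block_polyhedron_closed p (a : 'I_p -> vec) (b : 'I_p -> R)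
    (blk : 'I_p -> 'I_n) i : closed (block_polyhedron a b blk i).
Proof.
have -> : block_polyhedron a b blk i =
    \bigcap_(j in [set j | blk j = i])
      ((fun y => dot (submxcol (a j) i) y) @^-1` [set y | y <= b j]).
  by apply/seteqP; split=> y Py j; exact: Py.
apply: closed_bigI => j _; apply: closed_comp; last exact: closed_le.
by move=> y _; apply: (cvg_dotr (F := nbhs y)).
Qed.

End BlockVectors.

Section BlockBases.
Context {R : realType} {n : nat} {m mt : 'I_n -> nat}.
Variable B : forall i, 'M[R]_(m i, mt i).
Local Notation vec := 'cV[R]_(\sum_i m i).

Lemma submxcol_blockdiag_mul (z : 'cV[R]_(\sum_i mt i)) i :
  submxcol (blockdiag B *m z) i = B i *m submxcol z i.
Proof.
rewrite -{1}(submxcolK z) mul_mxblock_mxrow mxcolK (bigD1 i)//= eqxx.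
rewrite conform_mx_id big1 ?addr0// => j.
by rewrite eq_sym => /negbTE->; rewrite mul0mx.
Qed.

Lemma blockdiag_orthonormal :
  (forall i, (B i)^T *m B i = 1%:M) -> (blockdiag B)^T *m blockdiag B = 1%:M.
Proof.
move=> BB; have H (u : 'cV[R]_(\sum_i mt i)) :
      (blockdiag B)^T *m (blockdiag B *m u) = u.
  apply: subr0_eq; apply: dot_nondegenerate => v.
  rewrite dotC dotBr dot_mulmxr trmxK !dot_blocks -sumrB big1 // => i _.
  rewrite !submxcol_blockdiag_mul dot_mulmxr mulmxA BB mul1mx.
  exact: subrr.
apply/matrixP => i j; have /colP/(_ i) := H (delta_mx j ord0).
by rewrite mulmxA -colE !mxE andbT.
Qed.

End BlockBases.

Section Slices.
Context {R : realType} {n : nat} {m : 'I_n -> nat}.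
Local Notation vec := 'cV[R]_(\sum_i m i).

(** The inclusion of the [i]-th factor: [block_embed i *m d] is the vector
    whose [i]-th block is [d] and whose other blocks vanish. *)
Definition block_embed i : 'M[R]_(\sum_i m i, m i) := submxrow 1%:M i.

Lemma submxcol_block_embed i (d : 'cV[R]_(m i)) :
  submxcol (block_embed i *m d) i = d.
Proof.
rewrite -submxcol_mul -submxblockEh -mxdiagZ /mxdiag mxblockK eqxx.
by rewrite conform_mx_id mul1mx.
Qed.

Lemma submxcol_block_embed_neq i j (d : 'cV[R]_(m i)) : i != j ->
  submxcol (block_embed i *m d) j = 0.
Proof.
rewrite eq_sym => /negbTE ij.
rewrite -submxcol_mul -submxblockEh -mxdiagZ /mxdiag mxblockK ij.
by rewrite mul0mx.
Qed.

(** A slice is [f] composed with an affine map. *)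
Lemma sliceE (f : vec -> R) x i y :
  slice f x i y = f (x + block_embed i *m (y - submxcol x i)).
Proof.
rewrite /slice; congr f; apply/mxcolP => j; rewrite mxcolK submxcolD.
have [->|ij] := eqVneq j i.
  by rewrite dfwithin submxcol_block_embed addrC subrK.
by rewrite dfwithout ?submxcol_block_embed_neq ?addr0// eq_sym.
Qed.

Lemma block_embed_delta i (k : 'I_(m i)) :
  block_embed i *m delta_mx k (ord0 : 'I_1) = delta_mx (tagnat.Rank i k) ord0.
Proof.
rewrite -colE; apply/colP => s; rewrite !mxE andbT.
by [].
Qed.

Lemma gradient_slice (f : vec -> R) x i y :
  gradient (slice f x i) y =
  submxcol (gradient f (x + block_embed i *m (y - submxcol x i))) i.
Proof.
apply/colP => k; rewrite !mxE -block_embed_delta /derive; congr (lim _).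
apply: (congr1 (fun g => g @ 0^')); apply/funext => h /=; rewrite !sliceE.
congr (_ *: (f _ - _)).
by rewrite -addrA mulmxDr -scalemxAr addrCA.
Qed.

Lemma gradient_slice_block (f : vec -> R) x i :
  gradient (slice f x i) (submxcol x i) = submxcol (gradient f x) i.
Proof. by rewrite gradient_slice subrr mulmx0 addr0. Qed.

Lemma norm_submxcol_le (v : vec) i : `|submxcol v i| <= `|v|.
Proof.
by apply: mx_norm_leP => // k l; rewrite mxE coord_le_norm.
Qed.

Lemma norm_block_embed_le i (d : 'cV[R]_(m i)) : `|block_embed i *m d| <= `|d|.
Proof.
have H j (k : 'I_(m j)) : `|submxcol (block_embed i *m d) j k ord0| <= `|d|.
  have [ij|ij] := eqVneq i j; last first.
    by rewrite submxcol_block_embed_neq// mxE normr0.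
  by case: _ / ij k => k; rewrite submxcol_block_embed coord_le_norm.
apply: mx_norm_leP => // s l; have := H (tagnat.sig1 s) (tagnat.sig2 s).
by rewrite [submxcol _ _ _ _]mxE tagnat.sig2K (ord1 l).
Qed.

Lemma mulmx_differentiable p q r (A : 'M[R]_(p, q)) (B : 'M[R]_(q, r)) :
  differentiable (mulmx A : 'M[R]_(q, r) -> 'M[R]_(p, r)) B.
Proof. by apply: linear_differentiable; apply: mulmx_continuous. Qed.

Lemma smooth_convex_slice (f : vec -> R) x i :
  smooth_convex R _ f -> smooth_convex R _ (slice f x i).
Proof.
move=> [fcvx fdiff fgrad flip].
pose phi (y : 'cV[R]_(m i)) := x + block_embed i *m (y - submxcol x i).
have phiB y z : phi y - phi z = block_embed i *m (y - z).
  by rewrite /phi opprD addrACA subrr add0r -mulmxBr opprB addrA subrK.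
have phi_cont : continuous phi.
  move=> y.
  have H : z - submxcol x i @[z --> y] --> y - submxcol x i.
    by apply: (@cvgB _ _ _ (nbhs y) _ id (fun=> submxcol x i) y) => //; apply: cvg_cst.
  apply: (@cvgD _ _ _ (nbhs y) _ (fun=> x)); first exact: cvg_cst.
  exact: (cvg_mulmxr (F := nbhs y)).
have sliceP : slice f x i = f \o phi by apply/funext => y; rewrite sliceE.
split.
- move=> y z t yz t0 t1; rewrite !sliceP /=.
  have -> : phi (t *: y + (1 - t) *: z) = t *: phi y + (1 - t) *: phi z.
    rewrite -[phi (_ + _)](subrK (phi z)) phiB -[phi y](subrK (phi z)) phiB.
    have -> : t *: y + (1 - t) *: z - z = t *: (y - z).
      by rewrite scalerBl scale1r addrCA addrAC subrr add0r -scalerBr.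
    rewrite -scalemxAr scalerDr -addrA -scalerDl (addrCA t) subrr addr0.
    by rewrite scale1r.
  apply: fcvx => //; apply: contra yz => /eqP yz; rewrite -subr_eq0.
  apply/eqP; rewrite -[y - z]submxcol_block_embed -phiB yz subrr.
  exact: submxcol0.
- move=> y; rewrite sliceP; apply: differentiable_comp; last exact: fdiff.
  apply: differentiableD; first exact: differentiable_cst.
  have := @differentiable_comp R 'cV[R]_(m i) 'cV[R]_(m i) vec
    (fun y => y - submxcol x i) (fun d => block_embed i *m d) y; apply.
    by apply: differentiableB; [exact: ex_diff|exact: differentiable_cst].
  exact: mulmx_differentiable.
- rewrite (_ : gradient _ = (fun v => submxcol v i) \o (gradient f \o phi)); last first.
    by apply/funext => y; rewrite gradient_slice.
  move=> y; apply: continuous_comp.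
    by apply: continuous_comp; [exact: phi_cont|exact: fgrad].
  move: (_ y) => v; apply/(cvg_mxP (F := nbhs v)) => k l; rewrite mxE.
  by under eq_cvg do rewrite mxE; exact: coord_continuous.
- move: flip; rewrite /lipschitz_on /dominated_by /= => flip.
  near=> M => -[y z] _ /=; rewrite !gradient_slice -submxcolB.
  rewrite (le_trans (norm_submxcol_le _ _))//.
  have : forall yz : vec * vec, (setT `*` setT) yz ->
     `|gradient f yz.1 - gradient f yz.2| <= M * `|yz.1 - yz.2|.
    by near: M.
  move=> /(_ (phi y, phi z)) /= => H; rewrite (le_trans (H _))//.
  rewrite phiB ler_wpM2l ?norm_block_embed_le//.
Unshelve. all: by end_near. Qed.

End Slices.

(** * The variational inequality of a Jacobi step *)

Section JacobiStep.
Context {R : realType} {n : nat} {m : 'I_n -> nat}.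
Local Notation vec := 'cV[R]_(\sum_i m i).
Variables (tmin tmax : R) (f : vec -> R) (p : nat) (a : 'I_p -> vec).
Variables (b : 'I_p -> R) (blk : 'I_p -> 'I_n).
Variables (X : forall i, set 'cV[R]_(m i)) (T : scaling_map R n m).
Arguments X : clear implicits.
Arguments T : clear implicits.
Hypothesis tmin_gt0 : 0 < tmin.
Hypothesis tmin_le : tmin <= tmax.
Hypothesis f_smooth : smooth_convex R _ f.
Hypothesis XE : forall i, X i = block_polyhedron a b blk i.
Hypothesis T_scaling : forall i g y, smooth_convex R (m i) g -> X i y ->
  scaling_set tmin tmax (T i g y).

Lemma scaling_at_scaling_set x i : prodset X x ->
  scaling_set tmin tmax (scaling_at T f x i).
Proof. by move=> Xx; apply: T_scaling; [exact: smooth_convex_slice|exact: Xx]. Qed.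

(** On feasible points the argmin in the coordinate gradient projection is
    nonempty, so that the default value of [grad_proj] is never taken. *)
Lemma grad_proj_argmin x i : prodset X x ->
  argmin (X i) (fun y => dot (submxcol (gradient f x) i) (y - submxcol x i)
    + 2^-1 * dot (y - submxcol x i)
        (invmx (scaling_at T f x i) *m (y - submxcol x i)))
    (grad_proj X T f x i).
Proof.
move=> Xx; have ST := scaling_at_scaling_set i Xx.
have tmax_gt0 : 0 < tmax := lt_le_trans tmin_gt0 tmin_le.
have Mge v := scaling_set_invmx_ge v tmin_gt0 tmax_gt0 ST.
rewrite /grad_proj gradient_slice_block.
rewrite (_ : (fun y => _ + 2^-1 * normM _ _ ^+ 2) =
    (fun y => dot (submxcol (gradient f x) i) (y - submxcol x i)
    + 2^-1 * dot (y - submxcol x i)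
        (invmx (scaling_at T f x i) *m (y - submxcol x i)))); last first.
  apply/funext => y; rewrite normM_sqr// (le_trans _ (Mge _))//.
  by rewrite mulr_ge0 ?dot_ge0// invr_ge0 ltW.
apply: xgetPex; apply: (@quadratic_argmin_nonempty _ _ _ _ _ _ tmax^-1) => //.
- by rewrite XE; exact: block_polyhedron_closed.
- by exists (submxcol x i); exact: Xx.
- by rewrite invr_gt0.
Qed.

Lemma jacobi_prodset x : prodset X x -> prodset X (jacobi X T f x).
Proof. by move=> Xx i; rewrite mxcolK; case: (grad_proj_argmin i Xx). Qed.

(** The optimality conditions of the [n] blocks add up to a single variational
    inequality over the whole feasible set. *)
Lemma jacobi_VI x z : prodset X x -> prodset X z ->
  0 <= dot (gradient f x + invmx (\mxdiag_i scaling_at T f x i) *m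
              (jacobi X T f x - x)) (z - jacobi X T f x).
Proof.
move=> Xx Xz; rewrite invmx_mxdiag; last first.
  move=> i; exact: scaling_set_unit tmin_gt0 (scaling_at_scaling_set i Xx).
rewrite dot_blocks; apply: sumr_ge0 => i _.
rewrite submxcolD submxcol_mxdiag_mul !submxcolB mxcolK.
apply: (argmin_quadratic_VI (X := X i)) => //.
- by rewrite XE; exact: block_polyhedron_convex.
- exact: scaling_set_invmx_sym (scaling_at_scaling_set i Xx).
- exact: grad_proj_argmin.
Qed.

End JacobiStep.

(** * Identification of the active set and the reduced linear rate *)

Section ActiveSet.
Context {R : realType} {q p : nat}.
Variables (a : 'I_p -> 'cV[R]_q) (b : 'I_p -> R).
Local Notation P := [set x | forall j, dot (a j) x <= b j].

Lemma feasible_direction (y d : 'cV[R]_q) : P y ->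
  (forall j, dot (a j) y = b j -> dot (a j) d <= 0) ->
  exists2 t, 0 < t & P (y + t *: d).
Proof.
move=> Py dle.
have H : \forall t \near (0:R)^'+, forall j, dot (a j) (y + t *: d) <= b j.
  apply: filter_forall => j.
  have [yb|yb] := eqVneq (dot (a j) y) (b j).
    near=> t; rewrite dotDr dotZr yb gerDl pmulr_rle0; first exact: dle.
    by near: t; exact: nbhs_right_gt.
  have slack : 0 < b j - dot (a j) y by rewrite subr_gt0 lt_neqAle yb Py.
  have K0 : 0 < `|dot (a j) d| + 1 by rewrite ltr_wpDl.
  near=> t; rewrite dotDr dotZr.
  have t0 : 0 < t by near: t; exact: nbhs_right_gt.
  have : t < (b j - dot (a j) y) / (`|dot (a j) d| + 1).
    by near: t; exact: nbhs_right_lt (divr_gt0 slack K0).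
  rewrite ltr_pdivlMr// => tK; have := ler_norm (dot (a j) d); nra.
have [t [t0 Ht]] : exists t : R, 0 < t /\ forall j, dot (a j) (y + t *: d) <= b j.
  have HH : \forall t \near (0:R)^'+, 0 < t /\ forall j, dot (a j) (y + t *: d) <= b j.
    by near=> t; split; near: t; [exact: nbhs_right_gt|exact: H].
  exact: filter_ex HH.
by exists t.
Unshelve. all: by end_near. Qed.

Lemma VI_feasible_direction (w y d : 'cV[R]_q) : P y ->
  (forall z, P z -> 0 <= dot w (z - y)) ->
  (forall j, dot (a j) y = b j -> dot (a j) d <= 0) -> 0 <= dot w d.
Proof.
move=> Py VI /(feasible_direction Py)[t t0 /VI].
by rewrite addrAC subrr add0r dotZr pmulr_rge0.
Qed.

(** If [y k] solves the variational inequality with vector [w k] over the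
    polyhedron, and [w k] tends to minus a combination with positive
    coefficients of the normals active at [xs], then every constraint active at
    [xs] is eventually active at [y k].  Convergence of [y] is not needed.
    Suppose that some set [A] of constraints, missing a constraint active at
    [xs], is the active set of [y k0].  Then [d = xs - y k0] is a feasible
    direction at each [y k] with active set [A], so [<w k, d> >= 0] there,
    whereas strict complementarity makes the limit of [<w k, d>] negative.  So
    [A] is not the active set of [y k] for large [k], and there are finitely
    many sets [A]. *)
Lemma active_set_identification (xs ws : 'cV[R]_q) (lambda : 'I_p -> R)
    (y w : nat -> 'cV[R]_q) :
  P xs -> (forall k, P (y k)) ->
  (forall k z, P z -> 0 <= dot (w k) (z - y k)) ->
  w k @[k --> \oo] --> ws ->
  (forall j, dot (a j) xs == b j -> 0 < lambda j) ->
  ws = - \sum_(j | dot (a j) xs == b j) lambda j *: a j ->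
  \forall k \near \oo, forall j, dot (a j) xs == b j -> dot (a j) (y k) = b j.
Proof.
move=> Pxs Py VI ww lam0 wsE.
pose tight k : {set 'I_p} := [set j | dot (a j) (y k) == b j]%SET.
suff H : \forall k \near \oo, forall A : {set 'I_p}, tight k = A ->
    forall j, dot (a j) xs == b j -> j \in A.
  near=> k => j jxs.
  have Hk : forall A, tight k = A -> forall j, dot (a j) xs == b j -> j \in A.
    by near: k.
  by have := Hk _ erefl j jxs; rewrite inE => /eqP.
apply: filter_forall => A.
have [[k0 [j0 [k0A j0xs j0A]]]|noA] := pselect (exists k0 j0,
    [/\ tight k0 = A, dot (a j0) xs == b j0 & j0 \notin A]); last first.
  apply: nearW => k kA j jxs; apply/negPn/negP => jA.
  by apply: noA; exists k, j.
pose d := xs - y k0.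
have wd : dot ws d < 0.
  rewrite wsE dotNl oppr_lt0 dot_suml (bigD1 j0)//=.
  have term j : dot (a j) xs == b j -> 0 <= dot (lambda j *: a j) d.
    move=> jxs; rewrite dotZl mulr_ge0 ?(ltW (lam0 _ jxs))// /d dotBr (eqP jxs) subr_ge0.
    exact: Py.
  rewrite ltr_wpDr ?sumr_ge0// => [j /andP[jxs _]|]; first exact: term.
  rewrite dotZl mulr_gt0 ?lam0// /d dotBr (eqP j0xs) subr_gt0 lt_neqAle Py andbT.
  by move: j0A; rewrite -k0A inE.
have wkd : dot (w k) d @[k --> \oo] --> dot ws d.
  by under eq_cvg do rewrite dotC; rewrite dotC; exact: cvg_dotr.
near=> k => kA; exfalso.
have : dot (w k) d < 0 by near: k; apply: cvgr_lt wkd _ _.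
rewrite ltNge => /negP; apply; apply: (@VI_feasible_direction (w k) (y k)) => //.
- exact: VI.
move=> j jk; have : j \in tight k0 by rewrite k0A -kA inE jk.
by rewrite inE => /eqP jk0; rewrite dotBr jk0 subr_le0; exact: Pxs.
Unshelve. all: by end_near. Qed.

Lemma tight_near_active (xs : 'cV[R]_q) (y : nat -> 'cV[R]_q) :
  P xs -> y k @[k --> \oo] --> xs ->
  \forall k \near \oo, forall j, dot (a j) (y k) = b j -> dot (a j) xs == b j.
Proof.
move=> Pxs yy; apply: filter_forall => j.
have [jxs|jxs] := eqVneq (dot (a j) xs) (b j); first exact: nearW.
have lt_j : dot (a j) xs < b j by rewrite lt_neqAle jxs; exact: Pxs.
have : dot (a j) (y k) @[k --> \oo] --> dot (a j) xs by exact: cvg_dotr.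
move=> /cvgr_lt/(_ _ lt_j); apply: filterS => k /[swap] ->.
by rewrite ltxx.
Qed.

End ActiveSet.

Section GradientExpansion.
Context {R : realType} {q : nat}.

(** The differential acts as the matrix of partial derivatives. *)
Lemma diff_matrix r (G : 'cV[R]_q -> 'cV[R]_r) x (h : 'cV[R]_q) :
  differentiable G x ->
  'd G x h =
  (\matrix_(k, l) 'D_(delta_mx l ord0) (fun y => G y k ord0) x) *m h.
Proof.
move=> dG; rewrite {1}(matrix_sum_delta h) linear_sum.
apply/colP => k; rewrite !mxE summxE; apply: eq_bigr => l _.
rewrite big_ord1 linearZ !mxE mulrC; congr (_ * _).
have dv := @diff_derivable _ _ _ G x (delta_mx l ord0) dG.
by rewrite -deriveE// derive_mx// mxE.
Qed.

Lemma gradient_expansion (f : 'cV[R]_q -> R) xs (x : nat -> 'cV[R]_q) :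
  differentiable (gradient f) xs -> x k @[k --> \oo] --> xs ->
  forall e, 0 < e -> \forall k \near \oo,
    `|gradient f (x k) - gradient f xs - hessian f xs *m (x k - xs)|
      <= e * `|x k - xs|.
Proof.
move=> df xx e e0; have /eqaddoP/(_ e e0) := diff_locally df.
rewrite nearE /= => H.
have x0 : x k - xs @[k --> \oo] --> (0 : 'cV[R]_q).
  exact: cvg_sub_limit.
have {H} : \forall k \near \oo, `|gradient f (x k - xs + xs) -
    (gradient f xs + 'd (gradient f) xs (x k - xs))| <= e * `|x k - xs|.
  exact: x0 H.
by apply: filterS => k; rewrite subrK diff_matrix// opprD addrA.
Qed.

End GradientExpansion.

Section ReducedRate.
Context {R : realType} {q r : nat}.
Variables (E : 'M[R]_(q, r)) (H M0 : 'M[R]_q) (M : nat -> 'M[R]_q).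
Variables (xs gs : 'cV[R]_q) (x g : nat -> 'cV[R]_q).
Hypothesis M_cvg : M k @[k --> \oo] --> M0.
Hypothesis S_unit : E^T *m M0 *m E \in unitmx.
Hypothesis gs_normal : E^T *m gs = 0.
Hypothesis x_reduced :
  \forall k \near \oo, x k - xs = E *m (E^T *m (x k - xs)).
Hypothesis first_order :
  \forall k \near \oo, E^T *m (g k + M k *m (x k.+1 - x k)) = 0.
Hypothesis g_expansion : forall e, 0 < e -> \forall k \near \oo,
  `|g k - gs - H *m (x k - xs)| <= e * `|x k - xs|.

(** With [u k = E^T (x k - xs)], [S k = E^T M_k E] and the remainder [r k] of
    the expansion of [g k], the first-order condition reads
    [S k (u (k+1) - u k) = - (E^T H E u k + E^T r k)].  The error of the linear
    recursion with [S0 = E^T M0 E] is therefore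
    [(S0^-1 - (S k)^-1) E^T H E u k - (S k)^-1 E^T r k]; the first term is
    [o(u k)] since [S k] tends to [S0], the second since [r k] is [o(x k - xs)]
    and [x k - xs = E u k]. *)
Lemma reduced_rate e : 0 < e -> \forall k \near \oo,
  `|E^T *m (x k.+1 - xs)
    - (1%:M - invmx (E^T *m M0 *m E) *m (E^T *m H *m E)) *m (E^T *m (x k - xs))|
  <= e * `|E^T *m (x k - xs)|.
Proof.
move=> e0; set S0 := E^T *m M0 *m E; set Hr := E^T *m H *m E.
pose S k := E^T *m M k *m E.
have S_cvg : S k @[k --> \oo] --> S0.
  by apply: cvg_mulmx; [exact: cvg_mulmxr|exact: cvg_cst].
have S_near : \forall k \near \oo, S k \in unitmx by exact: near_unitmx S_cvg.
have SV_cvg : invmx (S k) @[k --> \oo] --> invmx S0 by exact: cvg_invmx.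
pose A k := (invmx S0 - invmx (S k)) *m Hr.
have A_cvg : A k @[k --> \oo] --> (0 : 'M[R]_r).
  rewrite -(mul0mx _ Hr); apply: cvg_mulmx; last exact: cvg_cst.
  exact: cvg_limit_sub.
have B_cvg : invmx (S k) *m E^T @[k --> \oo] --> invmx S0 *m E^T.
  by apply: cvg_mulmx => //; exact: cvg_cst.
(* [cB] bounds [(S k)^-1 E^T] for large [k] and [C] bounds the resulting factor in
   front of the remainder; adding 1 makes the first bound strict in the limit,
   and makes [C] and [r + 1] positive even if [q] or [r] is zero. *)
pose cB := `|invmx S0 *m E^T| + 1.
have cB0 : 0 < cB by rewrite ltr_wpDl.
pose C := q%:R * cB * (r%:R * `|E|) + 1.
have C0 : 0 < C.
  by apply: ltr_wpDl => //; apply: mulr_ge0 => //; rewrite mulr_ge0 ?(ltW cB0).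
pose eA := e / 2 / (r%:R + 1).
have r0 : 0 < r%:R + 1 :> R by rewrite ltr_wpDl.
have eA0 : 0 < eA by rewrite !divr_gt0.
have rate0 : 0 < e / 2 / C by rewrite !divr_gt0.
have x_reduced1 : \forall k \near \oo,
    x k.+1 - xs = E *m (E^T *m (x k.+1 - xs)).
  by have [N _ HN] := x_reduced; exists N => // k /= Nk; apply: HN; exact: leqW.
have B_le : \forall k \near \oo, `|invmx (S k) *m E^T| <= cB.
  by apply: cvgr_norm_le B_cvg _ _; rewrite ltrDl.
near=> k.
have uS : S k \in unitmx by near: k; exact: S_near.
have xk : x k - xs = E *m (E^T *m (x k - xs)) by near: k; exact: x_reduced.
have xk1 : x k.+1 - xs = E *m (E^T *m (x k.+1 - xs)).
  by near: k; exact: x_reduced1.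
have Ak : `|A k| <= eA.
  by near: k; apply: cvgr0_norm_le A_cvg _ _.
have Bk : `|invmx (S k) *m E^T| <= cB.
  by near: k; exact: B_le.
have rk_le : `|g k - gs - H *m (x k - xs)| <= e / 2 / C * `|x k - xs|.
  by near: k; exact: g_expansion.
have fo : E^T *m (g k + M k *m (x k.+1 - x k)) = 0.
  by near: k; exact: first_order.
set rk := g k - gs - _ in rk_le; set u := E^T *m (x k - xs) in xk *.
set u1 := E^T *m (x k.+1 - xs).
have step : S k *m (u1 - u) = - (Hr *m u + E^T *m rk).
  have -> : S k *m (u1 - u) = E^T *m (M k *m (x k.+1 - x k)).
    rewrite /S -!mulmxA mulmxBr -xk1 -xk opprB addrA subrK.
    by [].
  have -> : Hr *m u = E^T *m (H *m (x k - xs)) by rewrite /Hr -!mulmxA -xk.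
  rewrite -mulmxDr /rk (addrC (H *m _)) subrK (mulmxBr _ (g k)) gs_normal subr0.
  by apply/eqP; rewrite -addr_eq0 addrC -mulmxDr fo.
have -> : u1 - (1%:M - invmx S0 *m Hr) *m u = A k *m u - invmx (S k) *m E^T *m rk.
  have -> : u1 = u - invmx (S k) *m (Hr *m u + E^T *m rk).
    by rewrite -mulmxN -step mulKmx// addrC subrK.
  rewrite /A mulmxBl mul1mx mulmxDr !mulmxBl !mulmxA.
  move: (invmx (S k) *m Hr *m u) (invmx (S k) *m E^T *m rk) (invmx S0 *m Hr *m u).
  move=> v1 v2 v3; apply/colP => i; rewrite !mxE; ring.
rewrite (le_trans (ler_normB _ _))// (splitr e) mulrDl lerD//.
  rewrite (le_trans (ler_norm_mulmx _ _))// ler_wpM2r//.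
  rewrite (le_trans (ler_wpM2l _ Ak))//.
  have <- : eA * (r%:R + 1) = e / 2 by rewrite divfK// gt_eqF.
  by rewrite mulrDr mulr1 mulrC lerDl ltW.
rewrite (le_trans (ler_norm_mulmx _ _))//.
have xu : `|x k - xs| <= r%:R * `|E| * `|u| by rewrite xk ler_norm_mulmx.
have : q%:R * `|invmx (S k) *m E^T| * `|rk| <=
   q%:R * cB * (e / 2 / C * (r%:R * `|E| * `|u|)).
  apply: ler_pM => //; first by rewrite ler_wpM2l.
  by rewrite (le_trans rk_le)// ler_wpM2l// !divr_ge0// ltW.
move=> /le_trans; apply.
have -> : q%:R * cB * (e / 2 / C * (r%:R * `|E| * `|u|)) =
   e / 2 * `|u| * ((C - 1) / C).
  have -> : C - 1 = q%:R * cB * (r%:R * `|E|) by rewrite /C addrK.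
  by clearbody C; field; rewrite gt_eqF.
rewrite ler_piMr ?mulr_ge0 ?divr_ge0 ?(ltW e0)//.
by rewrite ler_pdivrMr// mul1r gerBl.
Unshelve. all: by end_near. Qed.

End ReducedRate.

(** * The reduced space and the asymptotic rate *)

Section ReducedBasis.
Context {R : realType} {n : nat} {m mt : 'I_n -> nat}.
Variables (p : nat) (a : 'I_p -> 'cV[R]_(\sum_i m i)) (b : 'I_p -> R).
Variables (blk : 'I_p -> 'I_n) (xs : 'cV[R]_(\sum_i m i)).
Variable Eb : forall i, 'M[R]_(m i, mt i).
Hypothesis a_block : single_block a blk.
Hypothesis Eb_basis : forall i, reduced_basis a b blk xs (Eb i).
Local Notation E := (blockdiag Eb).

Lemma reduced_basis_orthonormal : E^T *m E = 1%:M.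
Proof. by apply: blockdiag_orthonormal => i; case: (Eb_basis i). Qed.

Lemma active_dot_reduced_basis j v : active a b xs j -> dot (a j) (E *m v) = 0.
Proof.
move=> jxs; rewrite (dot_single_block _ _ a_block) submxcol_blockdiag_mul.
have [_ /(_ (Eb (blk j) *m submxcol v (blk j)))[+ _]] := Eb_basis (blk j).
by apply => //; exists (submxcol v (blk j)).
Qed.

(** The range of [E] is the orthogonal of the active normals, and [E E^T] is the
    identity on it. *)
Lemma reduced_basis_range (y : 'cV[R]_(\sum_i m i)) :
  (forall j, active a b xs j -> dot (a j) y = 0) -> y = E *m (E^T *m y).
Proof.
move=> ay; have zP i : exists z, submxcol y i = Eb i *m z.
  have [_ /(_ (submxcol y i))[_ ]] := Eb_basis i; apply => j ji jxs.
  by rewrite -ji -(dot_single_block _ _ a_block) ay.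
pose z : 'cV[R]_(\sum_i mt i) := \mxcol_i sval (cid (zP i)).
have -> : y = E *m z.
  apply/mxcolP => i; rewrite submxcol_blockdiag_mul mxcolK.
  exact: (svalP (cid (zP i))).
by rewrite (mulmxA E^T) reduced_basis_orthonormal mul1mx.
Qed.

End ReducedBasis.

Lemma cvg_scaling (R : realType) (n : nat) (m : 'I_n -> nat)
    (f : 'cV[R]_(\sum_i m i) -> R) (X : forall i, set 'cV[R]_(m i))
    (T : scaling_map R n m) (xs : 'cV[R]_(\sum_i m i))
    (x : nat -> 'cV[R]_(\sum_i m i)) :
  (forall i, scaling_at T f x i @[x --> within (prodset X) (nbhs xs)]
     --> scaling_at T f xs i) ->
  (forall k, prodset X (x k)) -> x k @[k --> \oo] --> xs ->
  \mxdiag_i scaling_at T f (x k) i @[k --> \oo] -->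
  \mxdiag_i scaling_at T f xs i.
Proof.
move=> hTcont Xx xx; apply: cvg_mxdiag => i.
have xw : x k @[k --> \oo] --> within (prodset X) (nbhs xs).
  move=> A HA; have : \forall k \near \oo, prodset X (x k) -> A (x k).
    exact: xx HA.
  by apply: filterS => k; apply; exact: Xx.
exact: (cvg_comp _ _ xw (hTcont i)).
Qed.

Theorem proposition5 (R : realType) (n : nat) (m : 'I_n -> nat)
    (tmin tmax : R) (htmin : 0 < tmin) (htmax : tmin <= tmax)
    (f : 'cV[R]_(\sum_i m i) -> R) (hf : smooth_convex R (\sum_i m i) f)
    (* the polyhedra X_i, described by the rows a_j, b_j *)
    (p : nat) (a : 'I_p -> 'cV[R]_(\sum_i m i)) (b : 'I_p -> R)
    (blk : 'I_p -> 'I_n) (ha : single_block a blk)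
    (X : forall i, set 'cV[R]_(m i))
    (hX : forall i, X i = block_polyhedron a b blk i)
    (hX0 : forall i, X i !=set0)
    (* block-diagonal Lipschitz matrix *)
    (L : forall i, 'M[R]_(m i)) (hLpos : forall i, posdef (L i))
    (hL : lipschitz_matrix f (\mxdiag_i L i))
    (* solution *)
    (xs : 'cV[R]_(\sum_i m i)) (hxs : argmin (prodset X) f = [set xs])
    (hsc : strict_complementarity a b f xs)
    (hC2 : twice_cont_diff_near f xs)
    (* scaling mappings *)
    (T : scaling_map R n m)
    (hT : forall i g y, smooth_convex R (m i) g -> X i y ->
       scaling_set tmin tmax (T i g y))
    (hTcont : forall i,
       scaling_at T f x i @[x --> within (prodset X) (nbhs xs)]
         --> scaling_at T f xs i)
    (* iterates *)
    (x : nat -> 'cV[R]_(\sum_i m i)) (hx0 : prodset X (x 0%N))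
    (hx : forall k, x k.+1 = jacobi X T f (x k))
    (hxlim : x k @[k --> \oo] --> xs)
    (* reduced space *)
    (mt : 'I_n -> nat) (Eb : forall i, 'M[R]_(m i, mt i))
    (hE : forall i, reduced_basis a b blk xs (Eb i)) :
  let E := blockdiag Eb in
  let Tt := reduced_scaling E (\mxdiag_i scaling_at T f xs i) in
  let Jt := 1%:M - Tt *m reduced_hessian E f xs in
  exists xt : nat -> 'cV[R]_(\sum_i mt i),
    (\forall k \near \oo, x k = xs + E *m xt k) /\
    (forall k, xt k.+1 = Jt *m xt k +o_(k \near \oo) xt k).
Proof.
move=> E Tt Jt.
have XP z : prodset X z <-> forall j, dot (a j) z <= b j.
  rewrite -(prodset_polyhedronP b z ha).
  by split=> Xz i; have := Xz i; rewrite hX.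
have Xxs : prodset X xs.
  have : [set xs] xs by [].
  by rewrite -hxs => -[].
have Xx k : prodset X (x k).
  by elim: k => // k IH; rewrite hx; exact: (jacobi_prodset htmin htmax hf hX hT).
have tmax_gt0 : 0 < tmax := lt_le_trans htmin htmax.
pose D z := \mxdiag_i scaling_at T f z i.
have SD z : prodset X z -> scaling_set tmin tmax (D z).
  move=> Xz; apply: scaling_set_mxdiag => i.
  exact: (scaling_at_scaling_set hf hT).
pose M k := invmx (D (x k)); pose M0 := invmx (D xs).
have M_cvg : M k @[k --> \oo] --> M0.
  apply: cvg_invmx; first exact: scaling_set_unit (SD _ Xxs).
  exact: cvg_scaling hTcont Xx hxlim.
(* The vector of the variational inequality solved by [x k.+1]. *)
pose w k := gradient f (x k) + M k *m (x k.+1 - x k).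
have x1_cvg : x k.+1 @[k --> \oo] --> xs by rewrite cvg_shiftS.
have g_cvg : gradient f (x k) @[k --> \oo] --> gradient f xs.
  by case: hf => _ _ cg _; exact: (continuous_cvg _ (cg xs) hxlim).
have w_cvg : w k @[k --> \oo] --> gradient f xs.
  have -> : gradient f xs = gradient f xs + M0 *m (xs - xs).
    by rewrite subrr mulmx0 addr0.
  by apply: cvgD => //; apply: cvg_mulmx => //; exact: cvgB.
have VI k z : prodset X z -> 0 <= dot (w k) (z - x k.+1).
  by move=> Xz; rewrite /w hx; exact: (jacobi_VI htmin htmax hf hX hT).
(* From here on the feasible set is the plain polyhedron. *)
have VI' k z : (forall j, dot (a j) z <= b j) -> 0 <= dot (w k) (z - x k.+1).
  by move=> /XP; exact: VI.
have Px k : forall j, dot (a j) (x k) <= b j by exact/XP.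
have Pxs : forall j, dot (a j) xs <= b j by exact/XP.
have [lam [lam_gt0 gE]] := hsc.
have act1 : \forall k \near \oo, forall j, active a b xs j ->
    dot (a j) (x k.+1) = b j.
  apply: (@active_set_identification _ _ _ a b xs _ lam (fun k => x k.+1) w
    Pxs _ VI' w_cvg lam_gt0 gE) => k; exact: Px.
have act : \forall k \near \oo, forall j, active a b xs j -> dot (a j) (x k) = b j.
  exact: near_inftyS.
have tight1 : \forall k \near \oo, forall j, dot (a j) (x k.+1) = b j ->
    active a b xs j.
  exact: (@tight_near_active _ _ _ a b xs (fun k => x k.+1)).
have x_reduced : \forall k \near \oo, x k - xs = E *m (E^T *m (x k - xs)).
  apply: filterS act => k actk; apply: (reduced_basis_range ha hE) => j jxs.
  by rewrite dotBr actk// (eqP jxs) subrr.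
have aE j v : active a b xs j -> dot (a j) (E *m v) = 0.
  exact: (active_dot_reduced_basis ha hE).
have first_order : \forall k \near \oo, E^T *m w k = 0.
  apply: filterS tight1 => k tightk; apply: dot_nondegenerate => v.
  (* Both [E u] and [- E u] are feasible directions at [x k.+1]. *)
  have dle u : 0 <= dot (w k) (E *m u).
    apply: (@VI_feasible_direction _ _ _ a b (w k) (x k.+1) _ (Px k.+1) (VI' k)).
    by move=> j jk; rewrite aE//; exact: tightk.
  apply/eqP; rewrite -dot_mulmxr eq_le dle andbT -oppr_ge0 -dotNr -mulmxN.
  exact: dle.
have g_normal : E^T *m gradient f xs = 0.
  apply: dot_nondegenerate => v; rewrite -dot_mulmxr gE dotNl dot_suml.
  by rewrite big1 ?oppr0// => j jxs; rewrite dotZl aE ?mulr0.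
(* [S v = 0] forces [<E v, M0 E v> = 0], hence [E v = 0] and [v = E^T E v = 0]. *)
have S_unit : E^T *m M0 *m E \in unitmx.
  apply: unitmx_injective => v Sv.
  have Ev : E *m v = 0.
    apply: dot_eq0; apply/eqP; rewrite eq_le dot_ge0 andbT.
    have := scaling_set_invmx_ge (E *m v) htmin tmax_gt0 (SD _ Xxs).
    have -> : dot (E *m v) (M0 *m (E *m v)) = dot v (E^T *m M0 *m E *m v).
      by rewrite -!mulmxA [RHS]dot_mulmxr trmxK.
    by rewrite Sv dot0r pmulr_rle0 ?invr_gt0.
  by rewrite -(mul1mx v) -(reduced_basis_orthonormal hE) -mulmxA Ev mulmx0.
have g_exp := gradient_expansion (let: And3 _ dg _ := nbhs_singleton hC2 in dg) hxlim.
have rate := reduced_rate M_cvg S_unit g_normal x_reduced first_order g_exp.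
exists (fun k => E^T *m (x k - xs)); split.
  by apply: filterS x_reduced => k <-; rewrite addrC subrK.
move=> k; rewrite littleoE; first by rewrite [RHS]addrC /= subrK.
by move=> e e0; exact: rate.
Qed.
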